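(* Let $p$ be a prime, let $n\geq 2$ and $k\geq 2$, and let the group $G$ be a central product of two unitriangular groups $G_1\simeq \mathrm{UT}_k(\mathbb F_p)$ and $G_2\simeq \mathrm{UT}_n(\mathbb F_p)$. Then the Bogomolov multiplier of $G$ is trivial: $B_0(G)=0$.
   Context: For a finite group $G$, the Bogomolov multiplier of $G$ is $$B_0(G)=\bigcap_{A}\ker\{\mathrm{res}_G^A:H^2(G,\mathbb Q/\mathbb Z)\to H^2(A,\mathbb Q/\mathbb Z)\},$$ where $\mathbb Q/\mathbb Z$ has trivial $G$-action, $\mathrm{res}$ is the restriction map in group cohomology, and $A$ runs over all bicyclic subgroups of $G$ (a group is bicyclic if it is cyclic or a direct product of two cyclic groups). $\mathrm{UT}_n(\mathbb F_p)$ is the group of all $n\times n$ upper unitriangular matrices (upper triangular with all diagonal entries equal to $1$) with entries in the field $\mathbb F_p$ of $p$ elements. Central product: let $G_1,G_2$ be groups with a common central subgroup up to isomorphism, i.e. let $\theta:K_1\to K_2$ be an isomorphism, where $K_1\leq Z(G_1)$ and $K_2\leq Z(G_2)$. Let $E=G_1\times G_2$ (with $G_1,G_2$ regarded as subgroups of $E$). The central product $G_1*G_2$ of $G_1$ and $G_2$ (with respect to $\theta$) is the quotient group $E/N$, where $N=\{ab: a\in K_1,\ b\in K_2,\ \theta(a)=b^{-1}\}$, a central subgroup of $E$. *)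

(* Defs.v *)
From HB Require Import structures.
From mathcomp Require Import all_boot all_order all_algebra all_fingroup.
From mathcomp Require Import generic_quotient ring_quotient all_solvable.
From mathcomp Require Import boolp classical_sets.

Set Implicit Arguments.
Unset Strict Implicit.
Unset Printing Implicit Defensive.

Import GRing.Theory.
Local Open Scope ring_scope.

(* Num.int is a qualifier; int_num_subdef is the predicate underlying it. *)
Definition QmodZ : zmodType :=
  Quotient.quot (@Num.int_num_subdef rat : {pred rat}).

(* Second cohomology with trivial coefficients, by inhomogeneous cochains. *)
Section H2.
Variables (G : finGroupType) (M : zmodType).

Local Notation cochain2 := {ffun G * G -> M}.

Definition is_cocycle2 : {pred cochain2} := fun f =>
  [forall x, forall y, forall z,
    f (y, z) - f ((x * y)%g, z) + f (x, (y * z)%g) - f (x, y) == 0].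

Fact is_cocycle2_zmod_closed : zmod_closed is_cocycle2.
Proof.
split=> [|f g fZ gZ].
  apply/forallP=> x; apply/forallP=> y; apply/forallP=> z.
  by rewrite !ffunE !(subr0, addr0).
apply/forallP=> x; apply/forallP=> y; apply/forallP=> z; rewrite !ffunE.
move/forallP/(_ x)/forallP/(_ y)/forallP/(_ z)/eqP: fZ => fZ.
move/forallP/(_ x)/forallP/(_ y)/forallP/(_ z)/eqP: gZ => gZ.
apply/eqP; have := congr2 (fun a b => a - b) fZ gZ; rewrite /= subrr => <-.
rewrite !opprD !opprK [RHS]addrACA; congr (_ + _).
by rewrite [RHS]addrACA; congr (_ + _); apply: addrACA.
Qed.
HB.instance Definition _ :=
  GRing.isZmodClosed.Build cochain2 is_cocycle2 is_cocycle2_zmod_closed.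

Record cocycle2 := Cocycle2 {
  cocycle2_val :> cochain2;
  cocycle2P : cocycle2_val \in is_cocycle2 }.
HB.instance Definition _ := [isSub for cocycle2_val].
HB.instance Definition _ := [Choice of cocycle2 by <:].
HB.instance Definition _ := [SubChoice_isSubZmodule of cocycle2 by <:].

Definition is_coboundary2 : {pred cocycle2} := fun f =>
  `[< exists u : G -> M,
        forall x y, f (x, y) = u y - u (x * y)%g + u x >].

Fact is_coboundary2_zmod_closed : zmod_closed is_coboundary2.
Proof.
split=> [|f g /asboolP[u fu] /asboolP[v gv]]; apply/asboolP.
  by exists (fun=> 0) => x y; rewrite ffunE subr0 addr0.
exists (fun x => u x - v x) => x y; rewrite !ffunE fu gv.
rewrite !opprD !opprK [LHS]addrACA; congr (_ + _).
by rewrite [LHS]addrACA.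
Qed.
HB.instance Definition _ :=
  GRing.isZmodClosed.Build cocycle2 is_coboundary2 is_coboundary2_zmod_closed.

Definition H2 : zmodType := Quotient.quot is_coboundary2.

End H2.

Section Restriction.
Variables (G : finGroupType) (M : zmodType) (A : {group G}).

Definition res_cochain2 (f : {ffun G * G -> M}) :
    {ffun subg_of A * subg_of A -> M} :=
  [ffun ab => f (sgval ab.1, sgval ab.2)].

Fact res_cochain2_cocycle (f : cocycle2 G M) :
  res_cochain2 f \in @is_cocycle2 (subg_of A) M.
Proof.
apply/forallP=> x; apply/forallP=> y; apply/forallP=> z; rewrite !ffunE /=.
by have /forallP/(_ (sgval x))/forallP/(_ (sgval y))/forallP/(_ (sgval z)) :=
  cocycle2P f.
Qed.

Definition res_cocycle2 (f : cocycle2 G M) : cocycle2 (subg_of A) M :=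
  Cocycle2 (res_cochain2_cocycle f).

Definition res2 (c : H2 G M) : H2 (subg_of A) M :=
  \pi_(H2 (subg_of A) M)%qT (res_cocycle2 (repr c)).

Lemma res2_pi (f : cocycle2 G M) :
  res2 (\pi_(H2 G M)%qT f) = \pi_(H2 (subg_of A) M)%qT (res_cocycle2 f).
Proof.
rewrite /res2; case: piP => g /eqP; rewrite -Quotient.idealrBE.
move=> /asboolP[u fgu]; apply/esym/eqP; rewrite -Quotient.idealrBE.
apply/asboolP; exists (u \o sgval) => x y; rewrite /= -morphM ?inE // -fgu.
by rewrite !ffunE.
Qed.

Fact res2_zmod_morphism : zmod_morphism res2.
Proof.
move=> c d; rewrite -[c]reprK -[d]reprK -raddfB !res2_pi -raddfB; congr (\pi%qT).
by apply/val_inj/ffunP=> xy; rewrite !ffunE.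
Qed.
HB.instance Definition _ :=
  GRing.isZmodMorphism.Build (H2 G M) (H2 (subg_of A) M) res2
    res2_zmod_morphism.

End Restriction.

Definition bicyclic (gT : finGroupType) (A : {group gT}) : Prop :=
  cyclic A \/
  exists B C : {group gT}, [/\ cyclic B, cyclic C & (B \x C)%g = A].

Definition bogomolov_multiplier (G : finGroupType) : set (H2 G QmodZ) :=
  [set c | forall A : {group G}, bicyclic A -> res2 A c = 0]%classic.

(* {'GL_n(p)} consists of matrices of size n.-1.+1, which is n for n > 0. *)
Definition UT (n p : nat) : {set {'GL_n(p)}} :=
  [set u : {'GL_n(p)} |
    [forall i : 'I_n.-1.+1, forall j : 'I_n.-1.+1,
       (j <= i)%N ==> (GLval u i j == (i == j)%:R)]].

Fact UT_group_set n p : group_set (UT n p).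
Proof.
apply/group_setP; split=> [|u v].
  rewrite inE; apply/forallP=> i; apply/forallP=> j; apply/implyP.
  by rewrite GL_1E mxE.
have UTE (w : {'GL_n(p)}) : w \in UT n p ->
    forall i j : 'I_n.-1.+1, (j <= i)%N -> GLval w i j = (i == j)%:R.
  rewrite inE => /forallP wU i j ji.
  by have /forallP/(_ j)/implyP/(_ ji)/eqP := wU i.
move=> /UTE uU /UTE vU; rewrite inE; apply/forallP=> i; apply/forallP=> j.
apply/implyP=> ji; rewrite GL_MxE mxE; apply/eqP.
rewrite (bigD1 i) //= big1 => [|l li]; first by rewrite addr0 uU // eqxx mul1r vU.
have [il|] := leqP i l; last first.
  by move=> /ltnW/uU->; rewrite eq_sym (negPf li) mul0r.
rewrite vU ?(leq_trans ji il) //; case: eqP => [lj|]; last by rewrite mulr0.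
by case/eqP: li; apply/val_inj/eqP; rewrite eqn_leq il andbT lj.
Qed.
Canonical UT_group n p := Group (UT_group_set n p).

Section CentralProduct.
Variables (G1 G2 : finGroupType) (K1 : {group G1}) (K2 : {group G2}).
Variable theta : {morphism K1 >-> G2}.

Definition amalgam : {set G1 * G2} :=
  [set ab | [&& ab.1 \in K1, ab.2 \in K2 & theta ab.1 == ab.2^-1]]%g.

(* For an arbitrary set N, coset_of N is the quotient of the normaliser of N
   by the subgroup generated by N; amalgam_group_set and amalgam_normal show
   that for the central subgroups K1, K2 this is (G1 * G2) / amalgam. *)
Definition ext_central_product : finGroupType := coset_of amalgam.

Hypotheses (K1Z : (K1 \subset 'Z([set: G1]))%g)
           (K2Z : (K2 \subset 'Z([set: G2]))%g).

Lemma amalgam_group_set : group_set amalgam.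
Proof.
apply/group_setP; split=> [|[a b] [c d]].
  by rewrite inE /= !group1 morph1 invg1 eqxx.
rewrite !inE /= => /and3P[aK bK /eqP ab] /and3P[cK dK /eqP cd].
rewrite !groupM //= morphM // ab cd -invMg; apply/eqP; congr _^-1%g.
have /centerP[_ bC] := fintype.subsetP K2Z _ bK.
exact/esym/bC/finset.in_setT.
Qed.

Lemma amalgam_normal : (amalgam <| [set: G1 * G2])%g.
Proof.
apply/andP; split; first exact: finset.subsetT.
apply/fintype.subsetP=> -[x y] _; rewrite inE.
apply/fintype.subsetP=> _ /imsetP[[a b] abN ->]; have := abN; rewrite inE /=.
case/and3P=> /(fintype.subsetP K1Z)/centerP[_ aC].
move=> /(fintype.subsetP K2Z)/centerP[_ bC] _.
suff -> : ((a, b) ^ (x, y) = (a, b))%g by [].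
congr pair; apply/conjg_fixP/commgP.
  exact/aC/finset.in_setT.
exact/bC/finset.in_setT.
Qed.

End CentralProduct.

Arguments amalgam {G1 G2 K1} K2 theta.
Arguments ext_central_product {G1 G2 K1} K2 theta.
Arguments bogomolov_multiplier G : clear implicits.

(* Main.v *)
(** A class of H^2(G, Q/Z) lies in B_0(G) iff, in the corresponding central
    extension E -> G, commuting elements of G lift to commuting elements of E.
    As Q/Z is divisible, such an extension splits as soon as [E, E] meets its
    kernel trivially, so it suffices to prove the latter ([bogomolov_trivial]).

    For unitriangular groups, add the rows one at a time from the bottom: let V
    be the elementary abelian group of matrices concentrated in row m, and U the
    group of those concentrated in the rows below.  Let w in U be a single Jordan
    block.  The commutators [v, w] with v in V lift to a group W which meets the
    kernel trivially, because [v~, w~] = 1 as soon as [v, w] = 1, and reflection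
    of commutation applied to products of two transvections shows that W
    contains all lifted commutators of V and U.

    For a central product G1 * G2, an element of [E, E] in the kernel is c1 c2
    with ci in the derived subgroup of the preimage of Gi.  The image of c1 is
    central in G1, hence a commutator [x1, y1], and similarly c2 maps to some
    [x2, y2] with x2, y2 in G2.  Then c1 c2 is the lifted commutator of x1 x2
    and y1 y2, which commute in G. *)
From HB Require Import structures.
Require Import Defs.
From mathcomp Require Import all_boot all_order all_algebra all_fingroup.
From mathcomp Require Import all_solvable generic_quotient ring_quotient.
From mathcomp Require Import boolp classical_sets.

Set Implicit Arguments.
Unset Strict Implicit.
Unset Printing Implicit Defensive.

Import GRing.Theory.
(* Restores the finite-set lemmas shadowed by [classical_sets]. *)
Import fintype fingroup.fingroup boot.finset.
Local Open Scope group_scope.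
Local Open Scope set_scope.

(** * Morphisms reflecting commutation *)

Definition reflects_comm (gT rT : finGroupType) (D : {group gT})
    (f : {morphism D >-> rT}) (H : {group gT}) : Prop :=
  {in H &, forall x y, commute (f x) (f y) -> commute x y}.

(* The central extensions in play are the restrictions of [f] to [H]: a kernel
   element commutes with everything in [H] because its image does. *)
Definition bogomolov_trivial (rT : finGroupType) (G : {group rT}) : Prop :=
  forall (gT : finGroupType) (D : {group gT}) (f : {morphism D >-> rT})
      (H : {group gT}),
    H \subset D -> f @* H = G -> reflects_comm f H -> 'ker_(H^`(1)) f = 1.

Lemma bogomolov_trivial_isog (rT rT' : finGroupType) (G : {group rT})
    (G' : {group rT'}) :
  G \isog G' -> bogomolov_trivial G' -> bogomolov_trivial G.
Proof.
case/isogP=> h injh hG trG' gT D f H sHD fH f_comm.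
have fHG x : x \in H -> f x \in G.
  by move=> xH; rewrite -fH mem_morphim // (subsetP sHD).
have sHhD : H \subset f @*^-1 G.
  by apply/subsetP=> x xH; rewrite mem_morphpre ?fHG ?(subsetP sHD).
have fhH : (h \o f) @* H = G' by rewrite morphim_comp fH.
have hf_comm : reflects_comm [morphism of h \o f] H.
  move=> x y xH yH /= hxy; apply: f_comm => //; apply: (injmP injh).
  - by rewrite groupM ?fHG.
  - by rewrite groupM ?fHG.
  by rewrite !morphM ?fHG.
have := trG' _ _ _ _ sHhD fhH hf_comm; rewrite ker_comp => kh.
apply/trivgP/subsetP=> x /setIP[xH' /kerP fx].
have xH := subsetP (der_sub 1 H) x xH'.
rewrite -kh inE xH' /= mem_morphpre ?(subsetP sHD) //.
by rewrite fx ?(subsetP sHD) ?group1.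
Qed.

Section Reflection.
Variables (gT rT : finGroupType) (D : {group gT}) (f : {morphism D >-> rT}).
Variable H : {group gT}.
Hypotheses (sHD : H \subset D) (f_comm : reflects_comm f H).

Lemma reflects_commS (K : {group gT}) : K \subset H -> reflects_comm f K.
Proof. by move=> /subsetP sKH x y /sKH xH /sKH yH; apply: f_comm. Qed.

Lemma reflects_abelian (K : {group gT}) :
  K \subset H -> abelian (f @* K) -> abelian K.
Proof.
move=> /subsetP sKH /centsP cfK; apply/centsP=> x xK y yK.
by apply: f_comm; rewrite ?sKH //; apply: cfK; rewrite mem_morphim ?(subsetP sHD) ?sKH.
Qed.

(** The hypothesis makes [f x] commute with [f (a * b^-1)]. Conjugates in [H] can thus be compared
    through their images, with no ambiguity by kernel elements. *)
Lemma reflects_conj x a b : x \in H -> a \in H -> b \in H ->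
  f x ^ f a = f x ^ f b -> x ^ a = x ^ b.
Proof.
move=> xH aH bH fab; have sHDp := subsetP sHD.
suff /commgP/conjg_fixP xab : commute x (a * b^-1).
  by rewrite -[a in LHS](mulgKV b) conjgM xab.
apply: f_comm; rewrite ?groupM ?groupV //.
rewrite morphM ?morphV ?groupV ?sHDp //; apply/commgP/conjg_fixP.
by rewrite conjgM fab conjgK.
Qed.

Lemma der1_ker_inj x y : x \in H^`(1) -> y \in H^`(1) ->
  'ker_(H^`(1)) f = 1 -> f x = f y -> x = y.
Proof.
move=> xH' yH' kf fxy; have sH'D := subsetP (subset_trans (der_sub 1 H) sHD).
have : x * y^-1 \in 'ker_(H^`(1)) f.
  rewrite inE groupM ?groupV //=; apply/kerP; first by rewrite groupM ?groupV ?sH'D.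
  by rewrite morphM ?morphV ?groupV ?sH'D // fxy mulgV.
by rewrite kf => /set1P/eqP; rewrite -eq_mulgV1 => /eqP.
Qed.

End Reflection.

(** * Central products *)

Definition der1_center_comm (rT : finGroupType) (G : {group rT}) : Prop :=
  forall z, z \in G^`(1) -> z \in 'Z(G) ->
    exists x y, [/\ x \in G, y \in G & z = [~ x, y]].

Lemma der1_center_comm_isog (rT rT' : finGroupType) (G : {group rT})
    (G' : {group rT'}) :
  G \isog G' -> der1_center_comm G' -> der1_center_comm G.
Proof.
case/isogP=> h injh hG cG' z zG' zZ; have zG := subsetP (der_sub 1 G) z zG'.
have [||x [y [xG' yG' hz]]] := cG' (h z).
- by rewrite -hG -morphim_der // mem_morphim.
- by rewrite -hG -injm_center // mem_morphim.
move: xG' yG'; rewrite -hG => /morphimP[a _ aG xa] /morphimP[b _ bG yb].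
exists a, b; split=> //; apply: (injmP injh); rewrite ?groupR //.
by rewrite morphR // hz xa yb.
Qed.

Lemma bogomolov_trivial_cprod (rT : finGroupType) (G1 G2 G : {group rT}) :
    G1 \* G2 = G -> bogomolov_trivial G1 -> bogomolov_trivial G2 ->
    der1_center_comm G1 -> der1_center_comm G2 ->
  bogomolov_trivial G.
Proof.
move=> defG tr1 tr2 cc1 cc2 gT D f H sHD fH f_comm.
have [_ mulG cG12] := cprodP defG; have sHDp := subsetP sHD.
pose H1 := (H :&: f @*^-1 G1)%G; pose H2 := (H :&: f @*^-1 G2)%G.
have sH1 : H1 \subset H := subsetIl _ _; have sH2 : H2 \subset H := subsetIl _ _.
have lift (K : {group rT}) z : K \subset G -> z \in K ->
    exists2 x, x \in H :&: f @*^-1 K & f x = z.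
  move=> /subsetP sKG zK; have := sKG z zK; rewrite -fH => /morphimP[x xD xH fx].
  by exists x; rewrite // inE xH mem_morphpre // -fx.
have sG1 : G1 \subset G by rewrite -mulG mulG_subl.
have sG2 : G2 \subset G by rewrite -mulG mulG_subr.
have fIm (K : {group rT}) : K \subset G -> f @* (H :&: f @*^-1 K) = K.
  move=> sKG; apply/eqP; rewrite eqEsubset; apply/andP; split.
    by apply/subsetP=> _ /morphimP[x xD /setIP[_ /morphpreP[_ ?]] ->].
  apply/subsetP=> z /(lift K z sKG)[x xH <-]; rewrite mem_morphim //.
  by case/setIP: xH => /sHDp.
have f1 : f @* H1 = G1 by apply: fIm.
have f2 : f @* H2 = G2 by apply: fIm.
have sHD1 := subset_trans sH1 sHD; have sHD2 := subset_trans sH2 sHD.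
have ker1 := tr1 _ _ _ _ sHD1 f1 (reflects_commS f_comm sH1).
have ker2 := tr2 _ _ _ _ sHD2 f2 (reflects_commS f_comm sH2).
have cH12 : H2 \subset 'C(H1).
  apply/centsP=> x xH2 y yH1; apply: f_comm; [exact: (subsetP sH2) | exact: (subsetP sH1) |].
  apply: (centsP cG12); first by rewrite -f2 mem_morphim ?(subsetP sHD2).
  by rewrite -f1 mem_morphim ?(subsetP sHD1).
have defH : H1 \* H2 = H.
  rewrite cprodE //; apply/eqP; rewrite eqEsubset mul_subG //=.
  apply/subsetP=> x xH; have : f x \in G1 * G2 by rewrite mulG -fH mem_morphim ?sHDp.
  case/mulsgP=> z1 z2 z1G z2G fx; have [x1 x1H fx1] := lift _ _ sG1 z1G.
  rewrite -(mulKVg x1 x) mem_mulg // inE groupM ?groupV ?(subsetP sH1 x1) //=.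
  have [x1D xD] := (subsetP sHD1 x1 x1H, sHDp x xH).
  by rewrite mem_morphpre ?groupM ?groupV // morphM ?morphV ?groupV // fx fx1 mulKg.
have /cprodP[_ defH' _] := der_cprod 1 defH.
apply/trivgP/subsetP=> c /setIP[]; rewrite -defH' => /mulsgP[c1 c2 c1H c2H ->{c}].
have [c1H1 c2H2] := (subsetP (der_sub 1 _) _ c1H, subsetP (der_sub 1 _) _ c2H).
have [c1D c2D] := (subsetP sHD1 _ c1H1, subsetP sHD2 _ c2H2).
move/kerP; rewrite groupM // morphM // => /(_ isT) /eqP.
rewrite mulg_eq1 => /eqP fc12.
have fc1 : f c1 \in G1^`(1) by rewrite -f1 -morphim_der // mem_morphim.
have fc2 : f c2 \in G2^`(1) by rewrite -f2 -morphim_der // mem_morphim.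
have fc1' := subsetP (der_sub 1 _) _ fc1; have fc2' := subsetP (der_sub 1 _) _ fc2.
(* [f c1] is the inverse of [f c2], which lies in [G2] and is therefore centralised by [G1]. *)
have fc1Z : f c1 \in 'Z(G1).
  rewrite inE fc1' /=; apply/centP => x xG1; rewrite fc12.
  by apply/commute_sym/commuteV/commute_sym; apply: (centsP cG12).
have fc2Z : f c2 \in 'Z(G2).
  rewrite inE fc2' /=; apply/centP => x xG2.
  by rewrite -[f c2]invgK -fc12; apply/commute_sym/commuteV; apply: (centsP cG12).
have [x1 [y1 [x1G y1G fc1E]]] := cc1 _ fc1 fc1Z.
have [x2 [y2 [x2G y2G fc2E]]] := cc2 _ fc2 fc2Z.
have [a1 a1H fa1] := lift _ _ sG1 x1G; have [b1 b1H fb1] := lift _ _ sG1 y1G.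
have [a2 a2H fa2] := lift _ _ sG2 x2G; have [b2 b2H fb2] := lift _ _ sG2 y2G.
have D1 := subsetP sHD1; have D2 := subsetP sHD2.
(* Both sides lie in the derived subgroup of [H1], on which [f] is injective by [ker1]. *)
have c1E : c1 = [~ a1, b1].
  apply: (der1_ker_inj sHD1 _ _ ker1) => //; first exact: mem_commg.
  by rewrite morphR ?D1 // fa1 fb1.
have c2E : c2 = [~ a2, b2].
  apply: (der1_ker_inj sHD2 _ _ ker2) => //; first exact: mem_commg.
  by rewrite morphR ?D2 // fa2 fb2.
have commE (T : finGroupType) (A B : {group T}) (a b c d : T) : B \subset 'C(A) ->
    a \in A -> b \in A -> c \in B -> d \in B ->
    [~ a, b] * [~ c, d] = [~ a * c, b * d].
  move=> cAB aA bA cB dB; have cc := centsP cAB.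
  rewrite commMgJ !commgMJ.
  have -> : [~ a, d] = 1 by apply/eqP/commgP/commute_sym/cc.
  have -> : [~ c, b] = 1 by apply/eqP/commgP/cc.
  have fixB t : t \in B -> [~ a, b] ^ t = [~ a, b].
    by move=> tB; apply/conjg_fixP/commgP/commute_sym/cc; rewrite ?groupR.
  by rewrite conj1g mul1g mulg1 !fixB.
rewrite inE c1E c2E (commE _ H1 H2) //; apply/commgP/f_comm.
- by apply: groupM; [apply: (subsetP sH1) | apply: (subsetP sH2)].
- by apply: groupM; [apply: (subsetP sH1) | apply: (subsetP sH2)].
apply/commgP; rewrite !morphM ?(D1 a1, D1 b1, D2 a2, D2 b2) // fa1 fa2 fb1 fb2.
by rewrite -(commE _ G1 G2) // -fc1E -fc2E fc12 mulVg.
Qed.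

(** * Transvections and unitriangular groups *)

Section Unitriangular.
Variables (n p : nat).
Local Notation N := n.-1.
Implicit Types (i j k l : 'I_N.+1) (u v : {'GL_n(p)}).

Definition unitri (M : 'M['F_p]_N.+1) : Prop :=
  forall i j, (j <= i)%N -> M i j = (i == j)%:R%R.

Lemma UTP u : reflect (unitri (GLval u)) (u \in UT n p).
Proof.
rewrite inE; apply: (iffP forallP) => [uU i j ji | uU i].
  by have /forallP/(_ j)/implyP/(_ ji)/eqP := uU i.
by apply/forallP=> j; apply/implyP=> ji; rewrite uU.
Qed.

Lemma unitri_unit (M : 'M['F_p]_N.+1) : unitri M -> M \in unitmx.
Proof.
move=> MU; rewrite unitmxE -det_tr det_trig.
  by rewrite big1 ?unitr1 // => i _; rewrite mxE MU // eqxx.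
apply/is_trig_mxP => i j ij; rewrite mxE MU; last exact: ltnW.
by rewrite -val_eqE /= eq_sym ltn_eqF.
Qed.

(** [insubd] makes this total; the default [1] is never met on unitriangular matrices, which are
    invertible. *)
Definition GL_of (M : 'M['F_p]_N.+1) : {'GL_n(p)} := insubd (1%g : {'GL_n(p)}) M.

Lemma GL_ofE M : M \in unitmx -> GLval (GL_of M) = M.
Proof. by move=> MU; apply: insubdK. Qed.

Lemma GLval_inj : injective (@GLval n 'F_p).
Proof. exact: val_inj. Qed.

End Unitriangular.

(* Locked because rewriting otherwise compares transvections by unfolding them. *)
HB.lock Definition transv (n p : nat) (i j : 'I_n.-1.+1) : {'GL_n(p)} :=
  GL_of (1 + delta_mx i j)%R.
(* A single Jordan block on the rows below [m]. *)
HB.lock Definition jordan (n p m : nat) : {'GL_n(p)} :=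
  GL_of (\matrix_(i, j) ((i == j) + ((m < i) && (i.+1 == j :> nat)))%N%:R)%R.

Section Transvections.
Variables (n p : nat).
Local Notation N := n.-1.
Implicit Types (i j k l : 'I_N.+1) (u v w : {'GL_n(p)}).
Local Notation t := (transv p).

Lemma unitri_transv i j : (i < j)%N -> @unitri n p (1 + delta_mx i j)%R.
Proof.
move=> ij a b ba; rewrite !mxE.
have [ai|] := eqVneq a i; last by rewrite addr0.
have [bj|] := eqVneq b j; last by rewrite addr0.
by rewrite ltnNge -bj -ai ba in ij.
Qed.

Lemma transvE i j : (i < j)%N -> GLval (t i j) = (1 + delta_mx i j)%R.
Proof. by move=> ij; rewrite transv.unlock; apply/GL_ofE/unitri_unit/unitri_transv. Qed.

Local Notation E := (@delta_mx 'F_p N.+1 N.+1).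

Lemma mul_delta_mxE i j k l : (E i j * E k l = E i l *+ (j == k))%R.
Proof. by rewrite -[LHS]/(_ *m _)%R mul_delta_mx_cond. Qed.

Lemma transvX i j a : (i < j)%N -> GLval (t i j ^+ a) = (1 + E i j *+ a)%R.
Proof.
move=> ij; elim: a => [|a IHa]; first by rewrite mulr0n addr0.
rewrite expgS GL_ME IHa transvE // mulrDl mul1r mulrDr mulr1 mulrnAr mul_delta_mxE.
by rewrite -val_eqE /= gtn_eqF // mul0rn addr0 -addrA -mulrSr.
Qed.

Lemma GL_commute u v : (GLval u * GLval v = GLval v * GLval u)%R -> commute u v.
Proof. by move=> uv; apply: GLval_inj; apply: uv. Qed.

Lemma GL_conj u v w : (GLval u * GLval v = GLval v * GLval w)%R -> u ^ v = w.
Proof. by move=> uv; apply: (mulgI v); rewrite -conjgC; apply: GLval_inj; apply: uv. Qed.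

Lemma transv_comm i j k l : (i < j)%N -> (k < l)%N -> j != k -> i != l ->
  commute (t i j) (t k l).
Proof.
move=> ij kl jk il; apply: GL_commute; rewrite (transvE ij) (transvE kl).
rewrite !mulrDl !mul1r !mulrDr !mulr1 !mul_delta_mxE (negPf jk) eq_sym (negPf il).
by rewrite !addr0 addrAC.
Qed.

Lemma transv_conj i j l : (i < j)%N -> (j < l)%N ->
  t i j ^ t j l = t i j * t i l.
Proof.
move=> ij jl; have il := ltn_trans ij jl.
apply: GL_conj; rewrite GL_ME (transvE ij) (transvE jl) (transvE il).
rewrite !mulrDl !mul1r !mulrDr !mulr1 !mul_delta_mxE eqxx.
rewrite -!val_eqE /=.
rewrite !(gtn_eqF ij, gtn_eqF il, gtn_eqF jl) !mulr0n !addr0.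
rewrite mulr1n mulr0 !addr0 -!addrA; congr (_ + _)%R.
by rewrite [RHS]addrA addrC [(_ + E i l)%R]addrC.
Qed.

(** Rows are counted from 0. Presenting the group by generators lets statements about lifted
    commutators be checked on transvections alone. *)
Definition lower_rows (m : nat) : {group {'GL_n(p)}} :=
  <<[set t ij.1 ij.2 | ij in [pred ij : 'I_N.+1 * 'I_N.+1 | m <= ij.1 < ij.2]]>>%G.

Lemma transv_lower_rows m i j : m <= i < j -> t i j \in lower_rows m.
Proof. by move=> ij; apply/mem_gen/imsetP; exists (i, j). Qed.

Lemma transv_UT i j : i < j -> t i j \in UT n p.
Proof.
by move=> ij; apply/UTP; rewrite transvE //; apply: unitri_transv.
Qed.

(** Gaussian elimination, by induction on the number of entries that differ from the identity. For
    such an entry (i, j) in the topmost possible row, column i of [u] is a unit vector, so right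
    multiplication by a power of [t i j] changes only the entry (i, j) and can clear it. *)
Lemma unitri_lower_rows m u : u \in UT n p ->
    (forall i j, i < m -> GLval u i j = (i == j)%:R%R) ->
  u \in lower_rows m.
Proof.
pose bad v := [set ij : 'I_N.+1 * 'I_N.+1 |
  GLval v ij.1 ij.2 != (ij.1 == ij.2)%:R%R].
have badE v x y : ((x, y) \in bad v) = (GLval v x y != (x == y)%:R%R).
  by rewrite /bad inE.
have [c] := ubnP #|bad u|; elim: c u => // c IHc u.
rewrite ltnS => le_c uUT rows_u; have [bad0 | [ij0 bad_ij0]] := set_0Vmem (bad u).
  suff -> : u = 1 by apply: group1.
  apply/GLval_inj/matrixP=> i j; rewrite GL_1E mxE; apply/eqP.
  by apply: contraFT (in_set0 (i, j)) => badij; rewrite -bad0 badE.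
have [ij bad_ij min_i] := @arg_minnP _ ij0 (mem (bad u)) (fun ij => val ij.1) bad_ij0.
case: ij => i j in bad_ij min_i; have {}bad_ij := etrans (esym (badE u i j)) bad_ij.
have ij : i < j.
  by rewrite ltnNge; apply: contraNN bad_ij => ji; rewrite (UTP _ uUT).
have neq_ij : (i == j) = false by rewrite -val_eqE ltn_eqF.
have col_i x : GLval u x i = (x == i)%:R%R.
  have [xi|ix] := ltnP x i; last by rewrite (UTP _ uUT).
  apply/eqP; apply: contraTT xi => bad_xi; rewrite -leqNgt.
  exact: min_i (x, i) (etrans (badE u x i) bad_xi).
(* The residue is read as a natural number, to serve as an exponent. *)
pose b : nat := (- GLval u i j)%R; pose u' := u * t i j ^+ b.
have u'E x y : GLval u' x y = (GLval u x y + (- GLval u i j) *+ ((x == i) && (y == j)))%R.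
  rewrite GL_ME transvX // mulrDr mulr1 mulrnAr mxE; congr (_ + _)%R.
  rewrite mulmxnE mxE (bigD1 i) //= big1 => [|z /negPf zi]; last first.
    by rewrite mxE zi mulr0.
  rewrite addr0 mxE eqxx col_i /=; case: (x == i) => /=; last by rewrite mul0r mul0rn.
  case: (y == j) => /=; last by rewrite mulr0 mul0rn.
  by rewrite mulr1 natr_Zp.
have mi : m <= i by rewrite leqNgt; apply: contraNN bad_ij => im; rewrite rows_u.
have tU : t i j \in lower_rows m by rewrite transv_lower_rows ?mi.
suff u'U : u' \in lower_rows m by rewrite -(groupMr _ (groupX b tU)).
apply: IHc => [||x y xm].
- suff -> : bad u' = bad u :\ (i, j) by rewrite (cardsD1 (i, j)) badE bad_ij in le_c.
  apply/setP=> [[x y]]; rewrite in_setD1 !badE u'E.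
  have -> : ((x, y) != (i, j)) = ~~ ((x == i) && (y == j)) by [].
  have [/andP[/eqP-> /eqP->]|_] := boolP ((x == i) && (y == j)); last by rewrite addr0.
  by rewrite /= mulr1n subrr neq_ij eqxx.
- apply/UTP=> x y yx; rewrite u'E (UTP _ uUT) //.
  rewrite [(x == i) && _]negbTE ?addr0 //.
  by apply: contraL yx => /andP[/eqP-> /eqP->]; rewrite -ltnNge.
by rewrite u'E -val_eqE (ltn_eqF (leq_trans xm mi)) addr0 rows_u.
Qed.

Lemma ord_ltn_neq (i j : 'I_N.+1) : i < j -> (i != j) * (j != i).
Proof. by move=> ij; split; rewrite neq_ltn ij ?orbT. Qed.

Lemma lower_rows_UT m : lower_rows m \subset UT n p.
Proof.
by rewrite gen_subG; apply/subsetP=> _ /imsetP[ij /andP[_ ij_lt] ->]; apply: transv_UT.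
Qed.

Lemma lower_rows0 : lower_rows 0 = UT n p :> {set _}.
Proof.
apply/eqP; rewrite eqEsubset lower_rows_UT.
by apply/subsetP=> u uUT; apply: unitri_lower_rows.
Qed.

Definition row_group i : {group {'GL_n(p)}} :=
  <<[set t i j | j in [pred j : 'I_N.+1 | i < j]]>>%G.

Lemma transv_row_group i j : i < j -> t i j \in row_group i.
Proof. by move=> ij; apply/mem_gen/imsetP; exists j. Qed.

Lemma row_group_abelian i : abelian (row_group i).
Proof.
rewrite abelian_gen; apply/centsP=> _ /imsetP[j ij ->] _ /imsetP[k ik ->].
by apply: transv_comm; rewrite ?(ord_ltn_neq ij) ?(ord_ltn_neq ik).
Qed.

Lemma lower_rows_norm i : lower_rows i.+1 \subset 'N(row_group i).
Proof.
rewrite gen_subG; apply/subsetP=> _ /imsetP[[k l] /andP[/= ik kl] ->].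
have il := ltn_trans ik kl.
rewrite inE -genJ gen_subG; apply/subsetP=> _ /imsetP[_ /imsetP[j ij ->] ->].
have [-> | jk] := eqVneq j k.
  by rewrite transv_conj // groupM ?transv_row_group.
rewrite (conjg_fixP _) ?transv_row_group //; apply/commgP/transv_comm => //.
by rewrite (ord_ltn_neq il).
Qed.

Lemma lower_rowsS i : row_group i * lower_rows i.+1 = lower_rows i.
Proof.
rewrite -norm_joinEr ?lower_rows_norm //; apply/eqP; rewrite eqEsubset join_subG.
rewrite !gen_subG -andbA; apply/and3P; split; apply/subsetP.
- by move=> _ /imsetP[j ij ->]; rewrite transv_lower_rows ?leqnn.
- move=> _ /imsetP[[k l] /andP[/= ik kl] ->]; rewrite transv_lower_rows // kl andbT.
  exact: ltnW.
move=> _ /imsetP[[k l] /andP[/= ik kl] ->]; move: ik; rewrite leq_eqVlt.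
case/orP=> [/eqP/val_inj ik | ik]; first rewrite -ik in kl *.
  by apply: mem_gen; apply/setUP; left; apply: transv_row_group.
by apply: mem_gen; apply/setUP; right; apply: transv_lower_rows; rewrite ik.
Qed.

(** Agreeing with the identity on the rows in [A] is stable under products. This bounds groups
    generated by transvections from above, which yields the trivial intersection of [row_group i]
    and [lower_rows i.+1]. *)
Definition fixed_rows (A : pred 'I_N.+1) : {set {'GL_n(p)}} :=
  [set u | [forall (i | A i), row i (GLval u) == row i 1%:M%R]].

Lemma fixed_rows_group_set A : group_set (fixed_rows A).
Proof.
apply/group_setP; split=> [|u v]; rewrite !inE.
  by apply/forall_inP=> i _.
move=> /forall_inP uA /forall_inP vA; apply/forall_inP=> i iA.
by rewrite GL_MxE row_mul (eqP (uA i iA)) -row_mul mul1mx vA.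
Qed.
Canonical fixed_rows_group A := Group (fixed_rows_group_set A).

Lemma transv_fixed_rows A i j : i < j -> ~~ A i -> t i j \in fixed_rows A.
Proof.
move=> ij Ai; rewrite inE; apply/forall_inP=> k Ak; apply/eqP/rowP=> l.
rewrite !mxE transvE // !mxE; case: (k =P i) Ak => [->|_ _]; first by rewrite (negPf Ai).
by rewrite addr0.
Qed.

Lemma lower_rows_fixed m : lower_rows m \subset fixed_rows [pred i : 'I_N.+1 | i < m].
Proof.
rewrite gen_subG; apply/subsetP=> _ /imsetP[[i j] /andP[/= mi ij] ->].
by rewrite transv_fixed_rows //= -leqNgt.
Qed.

Lemma row_group_fixed i : row_group i \subset fixed_rows (predC1 i).
Proof.
rewrite gen_subG; apply/subsetP=> _ /imsetP[j ij ->].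
by rewrite transv_fixed_rows //= eqxx.
Qed.

Lemma row_lower_rows_TI i : row_group i :&: lower_rows i.+1 = 1.
Proof.
apply/trivgP/subsetP=> u /setIP[/(subsetP (row_group_fixed i)) + ].
move=> + /(subsetP (lower_rows_fixed _)); rewrite !inE => /forall_inP uR /forall_inP uL.
apply/eqP/GLval_inj/row_matrixP=> k; rewrite GL_1E; apply/eqP.
by have [-> | ki] := eqVneq k i; [apply: (uL i (leqnn _)) | apply: uR].
Qed.

Lemma lower_rows_ge m : N <= m -> lower_rows m = 1 :> {set _}.
Proof.
move=> Nm; apply/trivgP; rewrite gen_subG; apply/subsetP=> u /imsetP[[i j] /andP[/= mi ij] _].
by have := leq_trans (leq_ltn_trans mi ij) (leq_ord j); rewrite ltnNge Nm.
Qed.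

Lemma jordanE m : GLval (jordan n p m) =
  (\matrix_(i, j) ((i == j) + ((m < i) && (i.+1 == j :> nat)))%N%:R)%R.
Proof.
rewrite jordan.unlock; apply/GL_ofE/unitri_unit => i j ji; rewrite mxE.
by rewrite [i.+1 == _]gtn_eqF ?ltnS // andbF addn0.
Qed.

Lemma jordan_lower_rows m : jordan n p m \in lower_rows m.+1.
Proof.
apply: unitri_lower_rows => [|i j im]; last first.
  by rewrite jordanE mxE ltnNge -ltnS im addn0.
apply/UTP=> i j ji; rewrite jordanE mxE.
by rewrite [i.+1 == _]gtn_eqF ?ltnS // andbF addn0.
Qed.

(** Row j of the Jordan block J is e_j + e_k and its column i is e_i, so E_ij J = E_ij + E_ik and J
    fixes both terms from the left. One element thus acts on every [t i j] as [t j j.+1] would. *)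
Lemma transv_jordan i j k : i < j -> k = j.+1 :> nat ->
  t i j ^ jordan n p i = t i j * t i k.
Proof.
move=> ij kj; have jk : j < k by rewrite kj.
have ik := ltn_trans ij jk.
apply: GL_conj; rewrite GL_ME.
have col_i l : GLval (jordan n p i) l i = (l == i)%:R%R.
  rewrite jordanE mxE; case: (ltnP i l) => [il|_]; last by rewrite addn0.
  by rewrite [l.+1 == _]gtn_eqF ?addn0 // ltnS ltnW.
have row_j l : GLval (jordan n p i) j l = ((l == j) + (l == k))%:R%R.
  by rewrite jordanE mxE ij -kj eq_sym val_eqE [k == l]eq_sym.
rewrite (transvE ij) (transvE ik) !mulrDl !mul1r !mulrDr !mulr1 mul_delta_mxE.
rewrite (negPf (ord_ltn_neq ij).2) mulr0n mulr0 addr0 -!addrA; congr (_ + _)%R.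
have mulJE l : (GLval (jordan n p i) * E i l = E i l)%R.
  apply/matrixP=> a b; rewrite mxE (bigD1 i) //= big1 => [|c /negPf ci]; last first.
    by rewrite mxE ci mulr0.
  by rewrite addr0 col_i !mxE eqxx -natrM mulnb.
rewrite !mulJE; apply/matrixP=> a b; rewrite !mxE (bigD1 j) //= big1; last first.
  by move=> c /negPf cj; rewrite mxE cj andbF mul0r.
rewrite addr0 mxE eqxx andbT row_j -natrM -natrD; congr (_%:R)%R.
by case: (a == i) => //=; rewrite mul1n addnC.
Qed.

Lemma center_UT u : u \in 'Z(UT n p) -> exists c, u = t ord0 ord_max ^+ c.
Proof.
move=> /setIP[uUT /centP uC]; have [N0 | N_gt0] := posnP N.
  exists 0; apply/set1P; rewrite expg0 -[[set 1]](@lower_rows_ge 0) ?N0 //.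
  by rewrite lower_rows0.
(* This is entry (a, b) of u E_ij = E_ij u. The choice (i, j) = (0, a) kills the entries above the
   diagonal outside row 0, and (i, j) = (b, N) kills those of row 0 before the last column. *)
have uE i j a b : i < j ->
    (GLval u a i *+ (b == j) = GLval u j b *+ (a == i))%R.
  move=> ij; have /(congr1 (@GLval n 'F_p)) := uC _ (transv_UT ij).
  rewrite !GL_ME transvE // mulrDl mulrDr mulr1 mul1r => /addrI/matrixP/(_ a b).
  rewrite mxE (bigD1 i) //= big1 => [|c /negPf ci]; last by rewrite mxE ci mulr0.
  rewrite [RHS]mxE (bigD1 j) //= big1 => [|c /negPf cj]; last first.
    by rewrite mxE cj andbF mul0r.
  by rewrite !mxE !eqxx !addr0 /= andbT mulr_natr mulr_natl.
exists (GLval u ord0 ord_max); apply/GLval_inj/matrixP=> a b.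
rewrite transvX // mxE mulmxnE !mxE -[(_ *+ nat_of_ord _)%R]mulr_natr natr_Zp.
have [ba | ab] := leqP b a.
  rewrite (UTP _ uUT) // [(a == ord0) && _]negbTE ?mul0r ?addr0 //.
  by apply: contraL ba => /andP[/eqP-> /eqP->]; rewrite -ltnNge.
rewrite (negPf (ord_ltn_neq ab).1) add0r.
have [a_0 | a0] := eqVneq a ord0; last first.
  rewrite mul0r; have a_gt0 : (ord0 : 'I_N.+1) < a by rewrite lt0n.
  have /esym := uE _ _ ord0 b a_gt0.
  by rewrite eqxx (negPf (ord_ltn_neq ab).2).
rewrite a_0; have [-> | bN] := eqVneq b ord_max; first by rewrite mul1r.
have b_lt : b < (ord_max : 'I_N.+1) by rewrite ltn_neqAle bN leq_ord.
have := uE _ _ ord0 ord_max b_lt.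
by rewrite eqxx mul0r mulr1n => ->; rewrite -a_0 (negPf (ord_ltn_neq ab).1).
Qed.

(** From size 3 on, a central element is a power of the corner transvection, and [t_01, t_1N^c] =
    t_0N^c. In smaller sizes the group is abelian, so membership in the derived subgroup forces
    [z = 1]. *)
Lemma der1_center_comm_UT : der1_center_comm (UT_group n p).
Proof.
move=> z zUT' zZ; have [N_le1 | N_gt1] := leqP N 1.
  suff UT'1 : (UT n p)^`(1) = 1.
    by exists 1, 1; rewrite !group1 comm1g; split=> //; apply/set1P; rewrite -[[set 1]]UT'1.
  apply/derG1P; rewrite /= -lower_rows0 -(lower_rowsS ord0) (lower_rows_ge N_le1) mulg1.
  exact: row_group_abelian.
have [c ->] := center_UT zZ; pose o : 'I_N.+1 := Ordinal (leqW N_gt1).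
have o_gt0 : (ord0 : 'I_N.+1) < o by [].
have oN : o < (ord_max : 'I_N.+1) by [].
exists (t ord0 o), (t o ord_max ^+ c); split; rewrite ?groupX ?transv_UT //.
have Rt : [~ t ord0 o, t o ord_max] = t ord0 ord_max.
  by rewrite commgEl transv_conj // mulKg.
have N_gt0 := ltn_trans o_gt0 oN; rewrite commgX Rt //; apply: transv_comm => //.
  exact: (ord_ltn_neq N_gt0).2.
exact: (ord_ltn_neq oN).1.
Qed.

End Transvections.

(** * The extension problem for unitriangular groups *)

Section Lifting.
Variables (gT rT : finGroupType) (D : {group gT}) (f : {morphism D >-> rT}).
Variable H : {group gT}.
Hypotheses (sHD : H \subset D) (f_comm : reflects_comm f H).
Let sHDp := subsetP sHD.

Lemma reflects_central a x : a \in H -> f a = 1 -> x \in H -> commute a x.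
Proof. by move=> aH fa xH; apply: f_comm; rewrite // fa; apply/commute_sym/commute1. Qed.

Lemma reflects_conj_fix x b :
  x \in H -> b \in H -> commute (f x) (f b) -> x ^ b = x.
Proof. by move=> xH bH xb; apply/conjg_fixP/commgP/f_comm. Qed.

(** Two commutators with the same image [z] could differ by a kernel element. Here [h] and [g]
    multiply [f k] and [f k1] by the same [z], so [z] cancels in the quotient [k * k1^-1];
    reflection turns this into an equality in [H]. *)
Lemma commg_exchange k k1 h g z :
    k \in H -> k1 \in H -> h \in H -> g \in H ->
    f k ^ f h = f k * z -> f k1 ^ f g = f k1 * z ->
    commute (f k1) (f h) -> commute (f k * z) (f g) ->
  [~ k, h] = [~ k1, g].
Proof.
move=> kH k1H hH gH kh k1g ck1h ckzg.
have k1h : k1 ^ h = k1 by apply: reflects_conj_fix.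
have khg : (k ^ h) ^ g = k ^ h.
  by apply: reflects_conj_fix; rewrite ?groupJ // morphJ ?sHDp // kh.
(* [k * k1^-1] and [h * g] commute because their images do. *)
have kk1 : (k * k1^-1) ^ (h * g) = k * k1^-1.
  apply: reflects_conj_fix; rewrite ?groupM ?groupV //; apply/commgP/conjg_fixP.
  rewrite !morphM ?morphV ?groupV ?sHDp // conjgM (conjMg (f k)) conjVg kh.
  rewrite (conjg_fixP (introT commgP ck1h)) (conjMg (f k * z)) conjVg k1g.
  by rewrite (conjg_fixP (introT commgP ckzg)) invMg mulgA mulgK.
move: kk1; rewrite conjgM (conjMg k) conjVg k1h (conjMg (k ^ h)) conjVg khg => kk1.
by rewrite !commgEl -[k ^ h](mulgKV (k1 ^ g)) kk1 !mulgA mulVg mul1g.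
Qed.

(** Reduces membership in [Q] to preimages of generators. A preimage of a product differs from the
    product of preimages by a kernel element, which the last hypothesis puts in [Q]. *)
Lemma lift_gen (S : {set rT}) (Q : {group gT}) :
    S \subset f @* H ->
    (forall x, x \in H -> f x \in S -> x \in Q) ->
    (forall x, x \in H -> f x = 1 -> x \in Q) ->
  forall x, x \in H -> f x \in <<S>> -> x \in Q.
Proof.
move=> sSfH QS Qk x xH.
have sS : <<S>> \subset f @* (H :&: Q).
  rewrite gen_subG; apply/subsetP=> s sS.
  have /morphimP[y yD yH sE] := subsetP sSfH s sS.
  by rewrite sE mem_morphim // inE yH QS // -sE.
case/(subsetP sS)/morphimP=> y yD /setIP[yH yQ] fxy.
suff : x * y^-1 \in Q by rewrite groupMr ?groupV.
apply: Qk; first by rewrite groupM ?groupV.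
by rewrite morphM ?morphV ?groupV ?sHDp // fxy mulgV.
Qed.

(** Modulo [K, L] the groups K and L commute and K is abelian, so (KL)' lies in [K, L] L'. Since the
    images of K and L meet trivially, a product r c in the kernel has both r and c in the kernel. *)
Lemma ker_der1_semidirect (K L : {group gT}) :
    K \subset H -> abelian K -> L \subset H -> L \subset 'N(K) ->
    f @* K :&: f @* L = 1 ->
    'ker_[~: K, L] f = 1 -> 'ker_(L^`(1)) f = 1 ->
  'ker_((K * L)^`(1)) f = 1.
Proof.
move=> sKH cKK sLH nKL tiKL kKL kL.
have sRK : [~: K, L] \subset K by rewrite commg_subl.
have nRL : L \subset 'N([~: K, L]) by rewrite commg_normr.
have nRK : K \subset 'N([~: K, L]) by rewrite commg_norml.
have defKL := norm_joinEr nKL.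
have sder : (K * L)^`(1) \subset [~: K, L] * L^`(1).
  rewrite -defKL; set M := (K <*> L)%G; have nR : M \subset 'N([~: K, L]).
    by rewrite join_subG nRK.
  have nRM' : M^`(1) \subset 'N([~: K, L]) := subset_trans (der_sub 1 M) nR.
  rewrite -quotientSK // !quotient_der //.
  have defM : quotient K [~: K, L] \* quotient L [~: K, L] = quotient M [~: K, L].
    rewrite cprodE; first by rewrite /M /= defKL quotientMl.
    by rewrite quotient_cents2 // commGC.
  have /cprodP[_ <- _] := der_cprod 1 defM.
  by rewrite (derG1P (quotient_abelian _ cKK)) mul1g.
apply/trivgP/subsetP=> x /setIP[/(subsetP sder)/mulsgP[r c rR cL' ->{x}] /kerP].
have [rK cL] := (subsetP sRK r rR, subsetP (der_sub 1 L) c cL').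
have [rD cD] := (sHDp (subsetP sKH r rK), sHDp (subsetP sLH c cL)).
rewrite groupM // morphM // => /(_ isT)/eqP; rewrite mulg_eq1 => /eqP frc.
have fr1 : f r = 1.
  apply/set1P; rewrite -[[set 1]]tiKL inE mem_morphim //= frc groupV.
  by rewrite mem_morphim.
have fc1 : f c = 1 by apply: invg_inj; rewrite -frc fr1 invg1.
have r1 : r \in 'ker_[~: K, L] f by rewrite inE rR; apply/kerP.
have c1 : c \in 'ker_(L^`(1)) f by rewrite inE cL'; apply/kerP.
by move: r1 c1; rewrite kKL kL !inE => /eqP-> /eqP->; rewrite mulg1.
Qed.

(* For a fixed [a], the commutators [[k, a]] with [k] in [K] form a group [W]
   because [K] is abelian, and [W] meets the kernel of [f] trivially because [f]
   reflects commutation. *)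
Lemma ker_commg_translates (S T : {set rT}) a :
    let K := (H :&: f @*^-1 <<S>>)%G in let L := (H :&: f @*^-1 <<T>>)%G in
    S \subset f @* H -> T \subset f @* H ->
    abelian K -> L \subset 'N(K) -> a \in L ->
    (forall k h, k \in H -> h \in H -> f k \in S -> f h \in T ->
      exists2 k', k' \in K & [~ k, h] = [~ k', a]) ->
  'ker_[~: K, L] f = 1.
Proof.
move=> K L sSH sTH cKK nKL aL STa; have nKLp := subsetP nKL.
have cKKp := centsP cKK.
have sKH : K \subset H := subsetIl _ _; have sLH : L \subset H := subsetIl _ _.
have KR k h : k \in K -> h \in L -> [~ k, h] \in K.
  by move=> kK hL; rewrite groupM ?groupV // memJ_norm ?nKLp.
have RM k l h : k \in K -> l \in K -> h \in L -> [~ k * l, h] = [~ k, h] * [~ l, h].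
  move=> kK lK hL; rewrite commMgJ; congr (_ * _); apply/conjg_fixP/commgP.
  by apply: cKKp => //; apply: KR.
pose W := [set [~ k, a] | k in K].
have W_group : group_set W.
  apply/group_setP; split; first by apply/imsetP; exists 1; rewrite ?group1 ?comm1g.
  move=> _ _ /imsetP[k kK ->] /imsetP[l lK ->]; apply/imsetP; exists (k * l).
    exact: groupM.
  by rewrite RM.
pose gW := Group W_group.
have sWK : gW \subset K.
  by apply/subsetP=> _ /imsetP[k kK ->]; apply: KR.
have inK x : x \in H -> f x \in <<S>> -> x \in K.
  by move=> xH fx; rewrite inE xH mem_morphpre ?sHDp.
have inL x : x \in H -> f x \in <<T>> -> x \in L.
  by move=> xH fx; rewrite inE xH mem_morphpre ?sHDp.
(* First [h] runs over preimages of [T] only, and [k] is reduced to preimages of [S]; [LW] then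
   reduces general [h] in [L] to this case. *)
have KW h k : h \in H -> f h \in T -> k \in K -> [~ k, h] \in gW.
  move=> hH fh; have hL : h \in L by rewrite inL ?mem_gen.
  pose Q := [set l in K | [~ l, h] \in gW].
  have Q_group : group_set Q.
    apply/group_setP; split=> [|l l']; first by rewrite inE !group1 comm1g group1.
    move=> /setIdP[lK lW] /setIdP[l'K l'W]; rewrite inE groupM //= RM //.
    exact: (@groupM _ gW).
  move=> kK; suff /setIdP[] : k \in Group Q_group by [].
  have /setIP[kH /morphpreP[_ fk]] := kK.
  apply: (lift_gen sSH _ _ kH fk) => x xH fx; rewrite inE.
    rewrite inK ?mem_gen //; have [k' k'K ->] := STa x h xH hH fx fh.
    exact: imset_f.
  rewrite inK ?fx ?group1 //.
  by have /commgP/eqP-> := reflects_central xH fx hH; apply: group1.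
have LW k h : k \in K -> h \in L -> [~ k, h] \in gW.
  move=> + hL; move: k; pose Q := [set h in L | [forall k in K, [~ k, h] \in gW]].
  have Q_group : group_set Q.
    apply/group_setP; split=> [|g g'].
      by rewrite inE !group1; apply/forall_inP=> k kK; rewrite commg1 group1.
    move=> /setIdP[gL /forall_inP gW'] /setIdP[g'L /forall_inP g'W].
    rewrite inE groupM //; apply/forall_inP=> k kK; rewrite commgMJ groupM ?g'W //.
    have kgW := gW' k kK; have kgK := subsetP sWK _ kgW.
    (* [k, g]^g' = [k, g] [[k, g], g'], and [k, g] is again in [K], so the property of g' applies to
       it. *)
    by rewrite -(mulKVg [~ k, g] (_ ^ g')) groupM // -commgEl g'W.
  suff /setIdP[_ /forall_inP] : h \in Group Q_group by [].
  have /setIP[hH /morphpreP[_ fh]] := hL.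
  apply: (lift_gen sTH _ _ hH fh) => x xH fx; rewrite inE.
    by rewrite inL ?mem_gen //; apply/forall_inP=> k kK; apply: KW.
  rewrite inL ?fx ?group1 //; apply/forall_inP=> k kK.
  have /commute_sym/commgP/eqP-> := reflects_central xH fx (subsetP sKH k kK).
  exact: group1.
have sRW : [~: K, L] \subset gW.
  by rewrite gen_subG; apply/subsetP=> _ /imset2P[k h kK hL ->]; apply: LW.
apply/trivgP/subsetP=> w /setIP[/(subsetP sRW)/imsetP[k kK ->{w}] /kerP].
have [kH aH] := (subsetP sKH k kK, subsetP sLH a aL).
rewrite groupR ?sHDp // morphR ?sHDp // => /(_ isT)/eqP/commgP fka.
by rewrite inE; apply/commgP/f_comm.
Qed.

End Lifting.

(** Both commutators lift t_il. The Jordan block produces t_il only from t_ij' with j' = l - 1, so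
    the commutator is first moved from the middle index j to j' by [commg_exchange]; there t_j'l and
    the Jordan block conjugate t_ij' alike. *)
Lemma commg_transv_jordan (n p : nat) (gT : finGroupType) (D : {group gT})
    (f : {morphism D >-> {'GL_n(p)}}) (H : {group gT}) (i j l : 'I_n.-1.+1) k h a :
    H \subset D -> f @* H = UT n p -> reflects_comm f H ->
    k \in H -> h \in H -> a \in H -> i < j -> j < l ->
    f k = transv p i j -> f h = transv p j l -> f a = jordan n p i ->
  exists k', [/\ k' \in H, f k' \in row_group p i & [~ k, h] = [~ k', a]].
Proof.
move=> sHD fH f_comm kH hH aH ij jl fk fh fa; have sHDp := subsetP sHD.
have lift (x y : 'I_n.-1.+1) : x < y -> exists2 z, z \in H & f z = transv p x y.
  by move=> /(transv_UT p); rewrite -fH => /morphimP[z _ zH ->]; exists z.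
have pl_lt : l.-1 < n.-1.+1 by rewrite (leq_ltn_trans (leq_pred l)).
pose j' := Ordinal pl_lt; have lE : l = j'.+1 :> nat by rewrite /= (ltn_predK jl).
have jj' : j <= j' by rewrite -ltnS -lE.
have ij' := leq_trans ij jj'; have j'l : j' < l by rewrite lE.
have [eq_j | ne_j] := eqVneq j j'.
  exists k; split; rewrite ?fk ?transv_row_group // !commgEl; congr (_ * _).
  apply: (reflects_conj sHD f_comm) => //; rewrite fk fh fa transv_conj //.
  by rewrite (@transv_jordan _ _ _ _ l ij) // [in RHS]eq_j.
have {}jj' : j < j' by rewrite ltn_neqAle jj' andbT.
have [k1 k1H fk1] := lift _ _ ij'; have [g gH fg] := lift _ _ j'l.
have il := ltn_trans ij jl.
exists k1; split; rewrite ?fk1 ?transv_row_group //.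
have k1a : k1 ^ a = k1 ^ g.
  apply: (reflects_conj sHD f_comm) => //.
  by rewrite fk1 fa fg transv_conj // (transv_jordan _ ij' lE).
rewrite [RHS]commgEl k1a -commgEl.
apply: (commg_exchange sHD f_comm (z := transv p i l)) => //.
- by rewrite fk fh transv_conj.
- by rewrite fk1 fg transv_conj.
- rewrite fk1 fh; apply: transv_comm => //; first exact: (ord_ltn_neq jj').2.
  exact: (ord_ltn_neq il).1.
rewrite fk fg; apply/commute_sym/commuteM; apply: transv_comm => //.
- exact: (ord_ltn_neq il).2.
- exact: (ord_ltn_neq jj').2.
- exact: (ord_ltn_neq il).2.
exact: (ord_ltn_neq j'l).1.
Qed.

Lemma bogomolov_trivial_UT (n p : nat) : bogomolov_trivial (UT_group n p).
Proof.
move=> gT D f H sHD fH f_comm; have sHDp := subsetP sHD.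
pose R m := (H :&: f @*^-1 (lower_rows n p m))%G.
have defR0 : R 0 = H.
  apply/val_inj/setIidPl/subsetP=> x xH /=; rewrite mem_morphpre ?sHDp //=.
  by rewrite lower_rows0 -fH mem_morphim ?sHDp.
(* [d] counts the rows from [m] on; at [d = 0] none is left and [R m] has trivial image. *)
suff kR d m : m + d = n.-1.+1 -> 'ker_((R m)^`(1)) f = 1 by rewrite -defR0 (kR n.-1.+1).
elim: d m => [|d IHd] m mdN.
  suff -> : (R m)^`(1) = 1 by apply/trivgP/subsetIl.
  apply/derG1P/(reflects_abelian sHD f_comm (subsetIl _ _)).
  apply: abelianS (abelian1 _); apply/subsetP=> _ /morphimP[x _ /setIP[_ xU] ->].
  by case/morphpreP: xU; rewrite lower_rows_ge // -ltnS -mdN addn0.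
have mN : m < n.-1.+1 by rewrite -mdN addnS ltnS leq_addr.
pose i := Ordinal mN; pose K := (H :&: f @*^-1 (row_group p i))%G.
have sKH : K \subset H := subsetIl _ _; have sRH : R m.+1 \subset H := subsetIl _ _.
have sfH (A : {set {'GL_n(p)}}) : A \subset UT n p -> A \subset f @* H by rewrite fH.
have fP (A : {group {'GL_n(p)}}) x : x \in H :&: f @*^-1 A -> f x \in A.
  by case/setIP=> _ /morphpreP[].
have sfP (A : {group {'GL_n(p)}}) : f @* (H :&: f @*^-1 A) \subset A.
  by apply/subsetP=> _ /morphimP[x _ /fP fx ->].
have cKK : abelian K.
  by apply: (reflects_abelian sHD f_comm sKH); apply: abelianS (sfP _) (row_group_abelian _ _).
have nKR : R m.+1 \subset 'N(K).
  rewrite normsI ?(subset_trans sRH (normG H)) //.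
  rewrite (subset_trans _ (morphpre_norm _ _)) //.
  apply: subset_trans (morphpreS _ (lower_rows_norm p i)); exact: subsetIr.
have sKU : row_group p i \subset lower_rows n p i by rewrite -lower_rowsS mulG_subl.
have sUU : lower_rows n p i.+1 \subset lower_rows n p i.
  by rewrite -(lower_rowsS p i) mulG_subr.
have sKUT := subset_trans sKU (lower_rows_UT n p i).
have defR : R m = K * R m.+1 :> {set gT}.
  apply/eqP; rewrite eqEsubset; apply/andP; split; last first.
    by apply: mul_subG; apply/setIS/morphpreS; [apply: sKU | apply: sUU].
  apply/subsetP=> x /[dup] xR /setIP[xH _].
  have /mulsgP[u v uK vR fx] : f x \in row_group p i * lower_rows n p i.+1.
    by rewrite lower_rowsS fP.
  have /morphimP[y yD yH fy] := subsetP (sfH _ sKUT) u uK.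
  have yK : y \in K by rewrite inE yH mem_morphpre // -fy.
  have [yxH yxD] : y^-1 * x \in H /\ y^-1 * x \in D.
    by rewrite !groupM ?groupV ?sHDp.
  rewrite -(mulKVg y x) mem_mulg // inE yxH mem_morphpre //.
  by rewrite morphM ?morphV ?groupV ?sHDp // fx fy mulKg.
rewrite defR; apply: (ker_der1_semidirect sHD) => //.
- apply/trivgP; rewrite -(row_lower_rows_TI p i); apply: setISS; exact: sfP.
- have [a aH fa] : exists2 a, a \in H & f a = jordan n p i.
    have : jordan n p i \in f @* H.
      by rewrite fH (subsetP (lower_rows_UT _ _ i.+1)) ?jordan_lower_rows.
    by case/morphimP=> a _ aH ->; exists a.
  apply: (ker_commg_translates sHD f_comm (a := a)) => //.
  + apply: sfH; apply: subset_trans (subset_gen _) sKUT.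
  + apply: sfH; apply: subset_trans (subset_gen _) _; exact: lower_rows_UT.
  + by rewrite inE aH mem_morphpre ?sHDp // fa jordan_lower_rows.
  move=> k h kH hH /imsetP[j ij fk] /imsetP[[j' l] /andP[/= ij' jl] fh].
  (* For distinct middle indices the transvections commute, hence so do their lifts, and the witness
     is 1. *)
  have [eq_j | ne_j] := eqVneq j j'; last first.
    exists 1; rewrite ?group1 // comm1g; apply/eqP/commgP/f_comm => //.
    rewrite fk fh; apply: transv_comm => //.
    by rewrite (ord_ltn_neq (ltn_trans (ij' : i < j') jl)).
  rewrite -eq_j in fh jl.
  have [k' [k'H fk' ->]] := commg_transv_jordan sHD fH f_comm kH hH aH ij jl fk fh fa.
  by exists k'; rewrite // inE k'H mem_morphpre ?sHDp.
by apply: IHd; rewrite addSn -addnS.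
Qed.

(** * From cocycles to group extensions *)

(** A copy of the product type that records [f], so that it can carry the twisted group law instead
    of that of the direct product. *)
Definition extension (G : finGroupType) (A : finZmodType) (f : cocycle2 G A) : Type :=
  (G * A)%type.

Section CocycleExtension.
Variables (G : finGroupType) (A : finZmodType) (f : cocycle2 G A).

Local Notation extension := (extension f).

Lemma cocycle2E x y z :
  (f (y, z) + f (x, y * z)%g = f ((x * y)%g, z) + f (x, y))%R.
Proof.
have /forallP/(_ x)/forallP/(_ y)/forallP/(_ z)/eqP := cocycle2P f.
by move/eqP; rewrite subr_eq0 addrAC subr_eq addrC => /eqP->; rewrite addrC.
Qed.

Lemma cocycle2_1l x : f (1, x) = f (1, 1).
Proof. by have := cocycle2E 1 1 x; rewrite !mul1g => /addrI. Qed.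

HB.instance Definition _ := Finite.on extension.

Definition extension_mul (u v : extension) : extension :=
  (u.1 * v.1, (u.2 + v.2 + f (u.1, v.1))%R).
(* The cocycle is not assumed to be normalised. *)
Definition extension_one : extension := (1, (- f (1%g, 1%g))%R).
Definition extension_inv (u : extension) : extension :=
  (u.1^-1, (- u.2 - f (u.1^-1, u.1)%g - f (1%g, 1%g))%R).

Fact extension_mulA : associative extension_mul.
Proof.
move=> [x a] [y b] [z c]; congr (_, _); rewrite /= ?mulgA //.
rewrite -!addrA; congr (_ + _)%R; congr (_ + _)%R.
rewrite [RHS]addrCA; congr (_ + _)%R; rewrite addrC [RHS]addrC.
by rewrite addrC cocycle2E.
Qed.

Fact extension_mul1 : left_id extension_one extension_mul.
Proof.
by move=> [x a]; congr (_, _); rewrite /= ?mul1g // (cocycle2_1l x) addrAC addNr add0r.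
Qed.

Fact extension_mulV : left_inverse extension_one extension_inv extension_mul.
Proof.
move=> [x a]; congr (_, _); rewrite /= ?mulVg //.
by rewrite [(_ + a)%R]addrC !addrA subrr add0r addrAC addNr add0r.
Qed.
HB.instance Definition _ := Finite_isGroup.Build extension
  extension_mulA extension_mul1 extension_mulV.

Definition extension_proj (u : extension) : G := u.1.
Fact extension_projM : {in [set: extension] &, {morph extension_proj : u v / u * v}}.
Proof. by []. Qed.
Canonical extension_proj_morphism := Morphism extension_projM.

Definition extension_inj (a : A) : extension := (1, (a - f (1%g, 1%g))%R).

Lemma extension_injM a b : extension_inj (a + b)%R = extension_inj a * extension_inj b.
Proof.
congr (_, _); rewrite /= ?mulg1 //.
by rewrite addrAC !addrA addrNK.
Qed.

Lemma extension_injE u : extension_proj u = 1 -> u = extension_inj (u.2 + f (1%g, 1%g))%R.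
Proof. by case: u => x a; rewrite /extension_proj /= => ->; congr (_, _); rewrite addrK. Qed.

Lemma extension_reflects :
    (forall x y, commute x y -> f (x, y) = f (y, x)) ->
  reflects_comm extension_proj_morphism [set: extension]%G.
Proof.
move=> f_comm [x a] [y b] _ _ /= xy; congr (_, _); rewrite /= ?xy //.
by rewrite (f_comm _ _ xy) [(a + b)%R]addrC.
Qed.

Lemma extension_proj_im : extension_proj @* [set: extension] = [set: G].
Proof.
apply/setP=> x; rewrite inE; apply/morphimP; exists (x, 0%R); rewrite ?inE //.
Qed.

(** The cocycle is the defect of the section sending x to (x, 0). A character of the extension that
    restricts suitably to the kernel therefore writes it as a coboundary. *)
Lemma extension_mulE x y :
  ((x, 0%R) : extension) * (y, 0%R) = extension_inj (f (x, y)) * (x * y, 0%R).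
Proof.
congr (_, _); rewrite /= ?mul1g // (cocycle2_1l (x * y)) addr0 add0r addr0.
by rewrite subrK.
Qed.

End CocycleExtension.

(** Injectivity of divisible groups, adjoining one element x at a time. With r the least positive
    exponent such that x^r is in H, and q chosen with r q = chi(x^r), the extension sends h x^i to
    chi(h) + i q. *)
Lemma extend_additive (T : finGroupType) (B : zmodType) (H : {group T}) (chi : T -> B) :
    (forall r (b : B), 0 < r -> exists q : B, (q *+ r = b)%R) ->
    abelian [set: T] -> {in H &, forall x y, chi (x * y) = (chi x + chi y)%R} ->
  exists psi : T -> B,
    (forall x y, psi (x * y) = (psi x + psi y)%R) /\ {in H, psi =1 chi}.
Proof.
move=> divB /centsP cTT; have cT (x y : T) : commute x y by apply: cTT.
have [c] := ubnP #|~: H|; elim: c H chi => // c IHc H chi ltc chiM.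
have [HT | /subsetPn[x _ xH]] := boolP ([set: T] \subset H).
  by exists chi; split=> // x y; apply: chiM; apply: (subsetP HT).
have chi1 : chi 1 = 0%R.
  by apply: (addrI (chi 1)); rewrite -chiM ?group1 // mulg1 addr0.
have chiX y k : y \in H -> chi (y ^+ k) = (chi y *+ k)%R.
  by move=> yH; elim: k => // k IHk; rewrite expgS chiM ?groupX // IHk mulrS.
have ex_r : exists r, (0 < r) && (x ^+ r \in H).
  by exists #[x]; rewrite order_gt0 expg_order group1.
have [r /andP[r_gt0 xrH] r_min] := ex_minnP ex_r.
have [q qE] := divB r (chi (x ^+ r)) r_gt0.
have r_dvd k : x ^+ k \in H -> r %| k.
  have xkrH : x ^+ (k %/ r * r) \in H by rewrite mulnC expgM; apply: groupX.
  rewrite {1}(divn_eq k r) expgD groupMl // => xkH.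
  rewrite /dvdn; case: posnP => // mod_gt0.
  by have := r_min _ (introT andP (conj mod_gt0 xkH)); rewrite leqNgt ltn_pmod.
have shift y i j : i <= j -> y * x ^- i \in H -> y * x ^- j \in H ->
    (chi (y * x ^- i)%g + q *+ i = chi (y * x ^- j)%g + q *+ j)%R.
  move=> ij yi yj; have yE : y * x ^- i = y * x ^- j * x ^+ (j - i).
    by rewrite -mulgA; congr (_ * _); rewrite -{1}(subnK ij) expgD invMg mulgKV.
  have xji : x ^+ (j - i) \in H by move: yi; rewrite yE groupMl.
  rewrite yE chiM // -addrA; congr (_ + _)%R.
  have [k kE] := dvdnP (r_dvd _ xji); rewrite -[in RHS](subnK ij) mulrnDr; congr (_ + _)%R.
  by rewrite kE mulnC expgM chiX // -qE mulrnA.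
have wd y i j : y * x ^- i \in H -> y * x ^- j \in H ->
    (chi (y * x ^- i)%g + q *+ i = chi (y * x ^- j)%g + q *+ j)%R.
  by move=> yi yj; case/orP: (leq_total i j) => ij; [|symmetry]; apply: shift.
pose H' := (H <*> <[x]>)%G.
(* An arbitrary exponent is chosen for each element of [H']; [wd] makes the value independent of
   it. *)
have /boolp.choice[ix ixP] y : exists i, y \in H' -> y * x ^- i \in H.
  have [yH'|] := boolP (y \in H'); last by exists 0.
  have nH : <[x]> \subset 'N(H).
    by apply: cents_norm; apply/centsP=> a _ b _; apply: cT.
  move: yH'; rewrite /H' /= norm_joinEr // => /mulsgP[h z hH /cycleP[i ->] ->].
  by exists i => _; rewrite mulgK.
pose chi' y := (chi (y * x ^- ix y)%g + q *+ ix y)%R.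
have [||psi [psiM psiE]] := IHc H' chi'.
- rewrite -ltnS; apply: leq_trans ltc; rewrite ltnS; apply: proper_card.
  rewrite properE setCS joing_subl setCS /=; apply: contraNN xH => /subsetP; apply.
  by rewrite mem_gen // inE cycle_id orbT.
- move=> y z yH' zH'; have yzH' : y * z \in H' by rewrite groupM.
  have E : y * z * x ^- (ix y + ix z) = (y * x ^- ix y) * (z * x ^- ix z).
    by rewrite expgD invMg -!mulgA; congr (_ * _); rewrite mulgA; apply: cT.
  rewrite {1}/chi' (wd _ _ (ix y + ix z)) ?ixP //; last by rewrite E groupM ?ixP.
  by rewrite E chiM ?ixP // mulrnDr addrACA.
exists psi; split=> // y yH.
have yH' : y \in H' by apply: (subsetP (joing_subl _ _)).
by rewrite psiE // /chi' (wd _ _ 0) ?ixP // expg0 invg1 mulg1 ?addr0.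
Qed.

(** An abelian group with two generators has rank at most 2, which bounds the number of cyclic
    factors in its decomposition. *)
Lemma abelian_rank2_bicyclic (gT : finGroupType) (x y : gT) (A : {group gT}) :
  commute x y -> A = <<[set x; y]>>%G -> bicyclic A.
Proof.
move=> xy ->; set B := <<[set x; y]>>%G.
have cBB : abelian B.
  rewrite abelian_gen; apply/centsP=> a /set2P aE b /set2P bE.
  by case: aE => ->; case: bE => -> //; apply/commute_sym.
have rB : 'r(B) <= 2.
  rewrite -grank_abelian // (leq_trans (grank_min _)) // cards2.
  by case: (_ != _).
have [b defB bT] := abelian_structure cBB.
have {bT} sb : size b <= 2 by rewrite -(size_map order) bT size_abelian_type.
case: b => [|a [|a' [|//]]] in defB sb.
- by left; rewrite -defB big_nil cyclic1.
- by left; rewrite -defB big_seq1 cycle_cyclic.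
right; exists <[a]>%G, <[a']>%G; rewrite !cycle_cyclic; split=> //.
by move: defB; rewrite big_cons big_seq1.
Qed.

(** * Divisibility and torsion of Q/Z *)

Section QmodZ.
Import Num.Theory.
Local Open Scope ring_scope.
Local Open Scope quotient_scope.

Lemma QmodZ_pi_eq0 (q : rat) : (\pi_QmodZ q == 0 :> QmodZ) = (q \is a Num.int).
Proof.
have -> : (0 : QmodZ) = \pi_QmodZ 0 by rewrite raddf0.
by rewrite -Quotient.idealrBE subr0.
Qed.

Lemma QmodZ_divisible r (b : QmodZ) : (0 < r)%N -> exists q : QmodZ, q *+ r = b.
Proof.
move=> r_gt0; exists (\pi_QmodZ (generic_quotient.repr b / r%:R)).
rewrite -raddfMn -[RHS]reprK; congr (\pi_QmodZ _).
by rewrite -[LHS]mulr_natr divfK // pnatr_eq0 -lt0n.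
Qed.

Variable m : nat.
(** Identifies the cyclic group ['I_m.+1] with the part of Q/Z killed by [m.+1]. *)
Definition fraction_mod1 (i : 'I_m.+1) : QmodZ := \pi_QmodZ ((i : nat)%:R / m.+1%:R).

Lemma fraction_mod1D i j : fraction_mod1 (i + j) = fraction_mod1 i + fraction_mod1 j.
Proof.
apply/eqP; rewrite eq_sym -raddfD -subr_eq0 -raddfB QmodZ_pi_eq0.
rewrite -mulrDl -mulrBl -natrD {1}(divn_eq (i + j) m.+1) natrD addrK natrM mulfK.
  exact: rpred_nat.
by rewrite pnatr_eq0.
Qed.

Lemma fraction_mod1B i j : fraction_mod1 (i - j) = fraction_mod1 i - fraction_mod1 j.
Proof. by apply/eqP; rewrite eq_sym subr_eq -fraction_mod1D subrK. Qed.

Lemma fraction_mod1_inj : injective fraction_mod1.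
Proof.
move=> i j ij; apply/eqP; rewrite -subr_eq0; set k := i - j.
have : fraction_mod1 k = 0.
  by rewrite fraction_mod1B ij subrr.
move/eqP; rewrite QmodZ_pi_eq0 => /intrP[z kz].
have m_neq0 : m.+1%:R != 0 :> rat by rewrite pnatr_eq0.
have {}kz : (k : nat)%:Z = z * m.+1%:Z.
  apply/eqP; rewrite -(eqr_int rat) intrM -kz; apply/eqP.
  by rewrite divfK.
have := dvdz_mull z (dvdzz m.+1); rewrite -kz dvdzE !absz_nat.
by rewrite /dvdn modn_small ?ltn_ord.
Qed.

Lemma fraction_mod1_surj (c : QmodZ) : c *+ m.+1 = 0 -> exists i, fraction_mod1 i = c.
Proof.
rewrite -[c]reprK; move: (generic_quotient.repr c) => q.
rewrite -raddfMn => /eqP; rewrite QmodZ_pi_eq0 => /intrP[z qz].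
have m_neq0 : m.+1%:R != 0 :> rat by rewrite pnatr_eq0.
have mz : m.+1%:Z != 0 by [].
have zm_lt : (`|(z %% m.+1)%Z| < m.+1)%N.
  by rewrite -ltz_nat gez0_abs ?modz_ge0 // ltz_pmod.
exists (Ordinal zm_lt); apply/eqP; rewrite -subr_eq0 -raddfB QmodZ_pi_eq0 /=.
have -> : q = z%:~R / m.+1%:R by rewrite -qz -[q *+ _]mulr_natr mulfK.
rewrite -mulrBl {2}(divz_eq z m.+1) intrD opprD addrCA.
have -> : (`|(z %% m.+1)%Z|%:R : rat) = (z %% m.+1)%Z%:~R.
  by rewrite -[in RHS](gez0_abs (modz_ge0 z mz)).
by rewrite subrr addr0 intrM mulNr mulfK // rpredN; apply: intr_int.
Qed.

End QmodZ.

(** A cocycle on a finite group has finitely many values, hence a common denominator. Finite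
    coefficients make the associated extension a finite group. *)
Lemma cocycle2_finite (G : finGroupType) (f : cocycle2 G QmodZ) :
  exists (m : nat) (f0 : cocycle2 G 'I_m.+1),
    forall xy, f xy = fraction_mod1 (f0 xy).
Proof.
pose d xy := `|denq (generic_quotient.repr (f xy))|%N.
have d_gt0 xy : 0 < d xy by rewrite /d absz_gt0 denq_eq0.
pose M := (\prod_xy d xy)%N; have M_gt0 : 0 < M by apply: prodn_gt0.
exists M.-1; have Mf xy : (f xy *+ M.-1.+1 = 0)%R.
  rewrite prednK // /M (bigD1 xy) //= mulrnA.
  suff -> : (f xy *+ d xy = 0)%R by rewrite mul0rn.
  rewrite -[f xy]reprK -raddfMn; apply/eqP; rewrite QmodZ_pi_eq0.
  by rewrite pmulrn /d absz_denq -mulrzr -numqE; apply: Num.Theory.intr_int.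
have /boolp.choice[g gE] xy := fraction_mod1_surj (Mf xy).
pose f0 : {ffun G * G -> 'I_M.-1.+1} := [ffun xy => g xy].
have f0P : f0 \in @is_cocycle2 G 'I_M.-1.+1.
  apply/forallP=> x; apply/forallP=> y; apply/forallP=> z; rewrite !ffunE.
  rewrite -(inj_eq (@fraction_mod1_inj _)) fraction_mod1B fraction_mod1D fraction_mod1B !gE.
  have -> : fraction_mod1 (0%R : 'I_M.-1.+1) = 0%R.
    by rewrite -(subrr (0%R : 'I_M.-1.+1)) fraction_mod1B subrr.
  by have /forallP/(_ x)/forallP/(_ y)/forallP/(_ z) := cocycle2P f.
by exists (Cocycle2 f0P) => xy; rewrite ffunE gE.
Qed.

(** On the bicyclic group generated by x and y the cocycle is a coboundary u(y) - u(xy) + u(x),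
    which is symmetric when xy = yx. *)
Lemma bicyclic_cocycle2_comm (G : finGroupType) (f : cocycle2 G QmodZ) x y :
    bogomolov_multiplier G (\pi_(H2 G QmodZ)%qT f) -> commute x y ->
  f (x, y) = f (y, x).
Proof.
move=> B0f xy; pose A := <<[set x; y]>>%G.
have := B0f A (abelian_rank2_bicyclic xy erefl); rewrite res2_pi => /eqP.
have -> : (0%R : H2 (subg_of A) QmodZ) = \pi_(H2 (subg_of A) QmodZ)%qT 0%R by rewrite raddf0.
rewrite -Quotient.idealrBE subr0 => /boolp.asboolP[u fu].
have xA : x \in A by rewrite mem_gen // !inE eqxx.
have yA : y \in A by rewrite mem_gen // !inE eqxx orbT.
have := fu (subg A x) (subg A y); have := fu (subg A y) (subg A x).
rewrite !ffunE /= !subgK // => -> ->.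
have -> : subg A x * subg A y = subg A y * subg A x.
  by apply: val_inj; rewrite /= !subgK.
by rewrite [LHS]addrAC [RHS]addrAC; congr (_ - _)%R; rewrite addrC.
Qed.

(** As E' meets the kernel trivially, the kernel embeds in E/E'. Its inclusion in Q/Z extends to a
    character of E/E' by divisibility, and this character along the section x -> (x, 0) trivialises
    the cocycle. *)
Lemma bogomolov_multiplier_trivial (G : finGroupType) :
  bogomolov_trivial [set: G]%G -> bogomolov_multiplier G = [set 0%R]%classic.
Proof.
move=> trG; apply/boolp.predeqP=> c; split=> [|->]; last first.
  by move=> A _; rewrite raddf0.
rewrite -[c]reprK; set f := generic_quotient.repr c => B0f.
have f_comm x y := @bicyclic_cocycle2_comm G f x y B0f.
have [m [f0 f0E]] := cocycle2_finite f.
have f0_comm x y : commute x y -> f0 (x, y) = f0 (y, x).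
  by move=> xy; apply: fraction_mod1_inj; rewrite -!f0E f_comm.
pose pr := extension_proj_morphism f0; pose E := extension f0.
have kE : 'ker_([set: E]^`(1)) pr = 1.
  apply: (trG _ _ _ [set: E]%G); rewrite ?subsetT ?extension_proj_im //.
  exact: extension_reflects.
pose E' := ([set: E]^`(1))%G.
have nE' x : x \in 'N(E') by rewrite (subsetP (der_norm 1 [set: E]%G)) ?inE.
have cEE : abelian [set: coset_of E'].
  have := der_abelian 0 [set: E]%G; rewrite derg0.
  by apply: abelianS; rewrite -quotientT quotientS //; apply/subsetP=> x _; rewrite inE.
pose A := ('ker pr / E')%G.
have injA a b : coset E' (extension_inj f0 a) = coset E' (extension_inj f0 b) -> a = b.
  case/(kercoset_rcoset (nE' _) (nE' _)) => z zE' zab.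
  have : z \in 'ker_E' pr.
    rewrite inE zE'; apply/kerP; rewrite ?inE //.
    by have /(congr1 pr) := zab; rewrite morphM ?inE // /= /extension_proj /= mulg1.
  rewrite kE => /set1P z1; move: zab; rewrite z1 mul1g => /(congr1 snd) /=.
  exact: addIr.
(* On [A], [g] inverts the embedding of the coefficients; the value 0 elsewhere is a default. *)
have /boolp.choice[g gE] t :
    exists a, t \in A -> t = coset E' (extension_inj f0 a).
  have [/morphimP[u _ /kerP pu ->] | _] := boolP (t \in A); last by exists 0%R.
  exists (u.2 + f0 (1%g, 1%g))%R => _; congr (coset E' _).
  by apply: extension_injE; apply: pu; rewrite inE.
have [|||psi [psiM psiE]] := @extend_additive _ QmodZ A (fun t => fraction_mod1 (g t)).
- exact: QmodZ_divisible.
- exact: cEE.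
- move=> s t sA tA; rewrite -fraction_mod1D; congr (fraction_mod1 _).
  by apply: injA; rewrite -gE ?groupM // extension_injM morphM //= -!gE.
have psiA a : psi (coset E' (extension_inj f0 a)) = fraction_mod1 a.
  have aA : coset E' (extension_inj f0 a) \in A.
    by rewrite mem_quotient //; apply/kerP; rewrite ?inE.
  by rewrite psiE // -(injA _ _ (gE _ aA)).
apply/eqP; have -> : (0%R : H2 G QmodZ) = \pi_(H2 G QmodZ)%qT 0%R by rewrite raddf0.
rewrite -Quotient.idealrBE subr0; apply/boolp.asboolP.
exists (fun x => psi (coset E' ((x, 0%R) : E))) => x y.
have xyE := congr1 (fun t => psi (coset E' t)) (extension_mulE f0 x y).
rewrite !morphM ?nE' //= !psiM in xyE.
by rewrite f0E -psiA addrAC [(psi (coset E' (y, _)) + _)%R]addrC xyE addrK.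
Qed.

(** * Central products of unitriangular groups *)

Theorem corollary3p2 (p n k : nat) (hp : prime p) (hn : (2 <= n)%N)
    (hk : (2 <= k)%N) (G1 G2 : finGroupType)
    (K1 : {group G1}) (K2 : {group G2}) (theta : {morphism K1 >-> G2})
    (hK1 : (K1 \subset 'Z([set: G1]))%g) (hK2 : (K2 \subset 'Z([set: G2]))%g)
    (htheta : isom K1 K2 theta)
    (hG1 : ([set: G1] \isog UT k p)%g) (hG2 : ([set: G2] \isog UT n p)%g) :
  bogomolov_multiplier (ext_central_product K2 theta) = [set 0%R]%classic.
Proof.
pose N := Group (amalgam_group_set theta hK2).
have nN : N <| [set: G1 * G2] := amalgam_normal theta hK1 hK2.
have nNp z : z \in 'N(N) by apply: (subsetP (normal_norm nN)); rewrite inE.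
have cosetM := coset_morphM (A := N).
have i1M : {in [set: G1] &, {morph (fun x => coset N (x, 1)) : x y / x * y}}.
  by move=> x y _ _ /=; rewrite -cosetM //; congr coset; congr (_, _); rewrite mulg1.
have i2M : {in [set: G2] &, {morph (fun y => coset N (1, y)) : x y / x * y}}.
  by move=> x y _ _ /=; rewrite -cosetM //; congr coset; congr (_, _); rewrite mulg1.
pose i1 := Morphism i1M; pose i2 := Morphism i2M.
have [inj_theta _] := isomP htheta.
(* An element (a, 1) of [N] has [theta a = 1], so a = 1 by injectivity of [theta]. For [inj2], an
   element (1, b) has b^-1 = [theta 1] = 1. *)
have inj1 : 'injm i1.
  apply/injmP=> x x' _ _ /(kercoset_rcoset (nNp _) (nNp _))[[a b]].
  rewrite inE /= => /and3P[aK _ /eqP tab] [-> b1]; rewrite mulg1 in b1; rewrite -b1 in tab.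
  rewrite (_ : a = 1) ?mul1g //; apply: (injmP inj_theta); rewrite ?group1 //.
  by rewrite tab invg1 morph1.
have inj2 : 'injm i2.
  apply/injmP=> y y' _ _ /(kercoset_rcoset (nNp _) (nNp _))[[a b]].
  rewrite inE /= => /and3P[_ _ /eqP tab] [a1 ->]; rewrite mulg1 in a1.
  by rewrite -a1 morph1 in tab; rewrite -[b]invgK -tab invg1 mul1g.
have isog1 : i1 @* [set: G1] \isog UT k p.
  by apply: isog_trans hG1; rewrite isog_sym sub_isog.
have isog2 : i2 @* [set: G2] \isog UT n p.
  by apply: isog_trans hG2; rewrite isog_sym sub_isog.
have defG : (i1 @* [set: G1]) \* (i2 @* [set: G2]) = [set: coset_of N].
  rewrite cprodE; last first.
    apply/centsP=> _ /morphimP[y _ _ ->] _ /morphimP[x _ _ ->] /=.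
    by rewrite /commute -!cosetM //; congr coset; congr (_, _); rewrite ?mul1g ?mulg1.
  apply/setP=> t; rewrite inE; have [[x y] _ ->] := cosetP t.
  have -> : (x, y) = (x, 1) * (1, y) by congr (_, _); rewrite ?mul1g ?mulg1.
  by rewrite cosetM //; apply: mem_mulg; apply/morphimP; [exists x | exists y]; rewrite ?inE.
apply: bogomolov_multiplier_trivial.
apply: (bogomolov_trivial_cprod defG).
- exact: bogomolov_trivial_isog isog1 (@bogomolov_trivial_UT k p).
- exact: bogomolov_trivial_isog isog2 (@bogomolov_trivial_UT n p).
- exact: der1_center_comm_isog isog1 (@der1_center_comm_UT k p).
exact: der1_center_comm_isog isog2 (@der1_center_comm_UT n p).
Qed.
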